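(* Let $k\ge 2$ be an integer, $q=2k-1$, and let $f=\sum_{n=0}^\infty f_n\chi_n$ be a radial function on the free group $\mathbb{F}_k$, with complex coefficients $f_n$. Put $$A(f):=\sum_{n,m=0}^\infty |f_n|\,|f_m|\,q^{(n+m)/2}\{1+\min(n,m)\}\in[0,\infty].$$ If $A(f)<+\infty$, then the operator $\lambda(f)$ is of weak type $(2,2)$. Moreover, if $f_n\ge 0$ for all $n$, then the condition $A(f)<+\infty$ is also necessary for $\lambda(f)$ to be of weak type $(2,2)$, and $$\frac16 A(f)\le \|\lambda(f)\|^2_{2\to(2,\infty)}\le 4A(f).$$
   Context: $\mathbb{F}_k$ is the free group on $k\ge2$ free generators $g_1,\dots,g_k$. The length $|x|$ of $x\in\mathbb{F}_k$ is the number of letters in its reduced form as a word in the generators and their inverses. $\chi_n$ is the indicator function of the set of elements of length $n$. The group carries counting measure, so that $L^p=\ell^p(\mathbb{F}_k)$. For a function $f$ on $\mathbb{F}_k$, $\lambda(f)$ is the left convolution operator $\lambda(f)g=f*g$, $(f*g)(x)=\sum_{y}f(xy^{-1})g(y)$. For $1<p<\infty$ and $p'=p/(p-1)$, weak $L^p$ is the space $L^{p,\infty}=\{h:\sup_{t>0}t^p|\{x:|h(x)|>t\}|<\infty\}$. It is normed as the dual of $L^{p',1}$, namely $\|h\|_{(p,\infty)}=\sup_{F}|\langle h,\chi_F\rangle|/|F|^{1/p'}$, the supremum being over finite nonempty subsets $F$ with indicator function $\chi_F$. A linear operator $T$ is of weak type $(p,p)$ if it maps $L^p$ boundedly into $L^{p,\infty}$.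 Its norm is $\|T\|_{p\to(p,\infty)}=\sup_{g\ne0}\|Tg\|_{(p,\infty)}/\|g\|_p$, equivalently $\|T\|_{p\to(p,\infty)}=\sup_{E}\|T^*\chi_E\|_{p'}/|E|^{1/p'}$ over finite nonempty sets $E$. *)

(* Defs.v *)
(* Complex numbers are R[i] over an arbitrary R : realType. *)
From HB Require Import structures.
From mathcomp Require Import all_boot all_order all_algebra finmap.
From mathcomp Require Import complex.
From mathcomp Require Import all_classical all_reals all_analysis.
From mathcomp Require summability.

Set Implicit Arguments.
Unset Strict Implicit.
Unset Printing Implicit Defensive.
Import Order.TTheory GRing.Theory Num.Theory.
Import numFieldNormedType.Exports.
Export Normc.

Local Open Scope classical_set_scope.
Local Open Scope ring_scope.
Local Open Scope complex_scope.

Section FreeGroup.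
Variable k : nat.

(* (i, true) is the generator g_i and (i, false) its inverse. *)
Definition letter : Type := 'I_k * bool.
HB.instance Definition _ := Choice.on letter.

Definition linv (a : letter) : letter := (a.1, ~~ a.2).

Definition reduced (w : seq letter) : bool :=
  sorted (fun a b => b != linv a) w.

Record free_group := FreeGroup { word :> seq letter; _ : reduced word }.
HB.instance Definition _ := [isSub for word].
HB.instance Definition _ := [Choice of free_group by <:].

Definition lcons (a : letter) (w : seq letter) : seq letter :=
  if w is b :: w' then if b == linv a then w' else a :: w else [:: a].

(* For reduced v and w, the reduced form of the concatenation v ++ w. *)
Definition wmul (v w : seq letter) : seq letter := foldr lcons w v.
Definition winv (w : seq letter) : seq letter := rev (map linv w).

Lemma linvK : involutive linv.
Proof. by case=> i b; rewrite /linv negbK. Qed.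

Lemma reduced_lcons a w : reduced w -> reduced (lcons a w).
Proof.
case: w => [//|b w] /= rw; case: ifPn => [_|ba]; first exact: path_sorted rw.
by rewrite /reduced /= ba.
Qed.

Lemma lconsK a w : reduced w -> lcons (linv a) (lcons a w) = w.
Proof.
case: w => [|b w] /= rw; first by rewrite linvK eqxx.
case: eqP => [bE|_] /=; last by rewrite linvK eqxx.
by case: w rw => [|c w] /=; rewrite bE // => /andP[/negPf ->].
Qed.

Lemma reduced_wmul v w : reduced w -> reduced (wmul v w).
Proof. by move=> rw; elim: v => //= a v; apply: reduced_lcons. Qed.

Lemma wmul_lcons a v w :
  reduced w -> wmul (lcons a v) w = lcons a (wmul v w).
Proof.
move=> rw; case: v => [//|b v] /=; case: eqP => [->|//].
by rewrite -[X in lcons X](linvK a) lconsK //; apply: reduced_wmul.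
Qed.

Lemma wmulA u v w : reduced w -> wmul u (wmul v w) = wmul (wmul u v) w.
Proof. by move=> rw; elim: u => //= a u ->; rewrite wmul_lcons. Qed.

Lemma wmulw1 w : reduced w -> wmul w [::] = w.
Proof.
elim: w => //= a w IH rw; rewrite IH; last exact: path_sorted rw.
by case: w rw {IH} => //= b w /andP[/negPf ->].
Qed.

Lemma wmulVw w : wmul (winv w) w = [::].
Proof.
elim: w => //= a w IH.
by rewrite /winv /= rev_cons /wmul foldr_rcons /= linvK eqxx; apply: IH.
Qed.

Lemma winvK : involutive winv.
Proof. by move=> w; rewrite /winv map_rev revK mapK //; apply: linvK. Qed.

Lemma wmulwV w : wmul w (winv w) = [::].
Proof. by rewrite -{1}(winvK w) wmulVw. Qed.

Lemma reduced_winv w : reduced w -> reduced (winv w).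
Proof.
rewrite /reduced /winv rev_sorted sorted_map; apply: sub_sorted => a b /=.
by rewrite /relpre /= linvK; apply: contraNN => /eqP ->.
Qed.

Definition fg_one : free_group := @FreeGroup [::] isT.
Definition fg_mul (x y : free_group) : free_group :=
  FreeGroup (reduced_wmul x (valP y)).
Definition fg_inv (x : free_group) : free_group :=
  FreeGroup (reduced_winv (valP x)).

Lemma fg_mulA : associative fg_mul.
Proof. by move=> x y z; apply/val_inj/wmulA/valP. Qed.
Lemma fg_mul1 : left_id fg_one fg_mul.
Proof. by move=> x; apply/val_inj. Qed.
Lemma fg_mulr1 : right_id fg_one fg_mul.
Proof. by move=> x; apply/val_inj/wmulw1/valP. Qed.
Lemma fg_mulV : left_inverse fg_one fg_inv fg_mul.
Proof. by move=> x; apply/val_inj/wmulVw. Qed.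
Lemma fg_mulrV : right_inverse fg_one fg_inv fg_mul.
Proof. by move=> x; apply/val_inj/wmulwV. Qed.

HB.instance Definition _ :=
  isGroup.Build free_group fg_mulA fg_mul1 fg_mulr1 fg_mulV fg_mulrV.

Definition fg_length (x : free_group) : nat := size (word x).

End FreeGroup.

(* chi n is the indicator function of the sphere of radius n. *)
Definition chi (R : realType) (k n : nat) (x : free_group k) : R[i] :=
  (fg_length x == n)%:R.

(* The pointwise sum of the series \sum_n c_n chi_n; see radial_series. *)
Definition radial (R : realType) (k : nat) (c : nat -> R[i])
  (x : free_group k) : R[i] := c (fg_length x).

Lemma radial_series (R : realType) (k : nat) (c : nat -> R[i])
    (x : free_group k) (N : nat) : (fg_length x < N)%N ->
  \sum_(n < N) c n * chi R n x = radial c x.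
Proof.
move=> xN; rewrite (bigD1 (Ordinal xN)) //= /chi eqxx mulr1 big1 ?addr0 //.
by move=> n /negPf nx; rewrite eq_sym -val_eqE /= in nx *; rewrite nx mulr0.
Qed.

Section Lp.
Variables (R : realType) (T : choiceType).
Implicit Types (p : R) (g h : T -> R[i]).
Local Open Scope ereal_scope.

Definition lpnorm p g : \bar R :=
  (\esum_(x in [set: T]) (normc (g x) `^ p)%:E) `^ p^-1.

Definition Lp p : set (T -> R[i]) := [set g | lpnorm p g < +oo].

Definition weakLp p : set (T -> R[i]) :=
  [set h | ereal_sup [set (t `^ p)%:E * counting [set x | (t < normc (h x))%R]
                     | t in [set t : R | (0 < t)%R]] < +oo].

Definition conj_exp p : R := (p / (p - 1))%R.

(* The norm of weak L^p as the dual of L^(p',1); the pairing of h with the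
   indicator function of the finite set F is the sum of h over F. *)
Definition weak_norm p h : \bar R :=
  ereal_sup [set (normc (\sum_(x <- F) h x) /
                  (#|` F|%:R `^ (conj_exp p)^-1))%:E
            | F in [set F : {fset T} | F != fset0]].

(* An operator on complex functions is given together with its domain:
   S g = None means that S g is undefined. *)
Implicit Type S : (T -> R[i]) -> option (T -> R[i]).

Definition weak_type p S : Prop :=
  exists C : R, forall g, Lp p g ->
    exists h, [/\ S g = Some h, weakLp p h &
                  weak_norm p h <= C%:E * lpnorm p g].

(* The norm of S from L^p to weak L^p, in [0, +oo]; it is +oo when S is not
   defined on all of L^p. *)
Definition weak_opnorm p S : \bar R :=
  ereal_sup [set (if S g is Some h then weak_norm p h else +oo) / lpnorm p g
            | g in [set g | Lp p g /\ g <> cst 0%R]].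

End Lp.

Section Convolution.
Variables (R : realType) (G : groupType).
Implicit Types f g : G -> R[i].

Definition conv_term f g (x y : G) : R[i] := f (x * y^-1)%g * g y.

Definition conv_defined f g : Prop :=
  forall x, (\esum_(y in [set: G]) (normc (conv_term f g x y))%:E < +oo)%E.

(* summability.sum is the limit of the net of finite partial sums. *)
Definition conv f g (x : G) : R[i] :=
  summability.sum (conv_term f g x : G -> R[i]^o).

(* Left convolution by f, defined at the g for which all the sums f * g (x)
   converge absolutely. *)
Definition lambda f : (G -> R[i]) -> option (G -> R[i]) :=
  fun g => if `[< conv_defined f g >] then Some (conv f g) else None.

End Convolution.

Definition A_sum (R : realType) (k : nat) (c : nat -> R[i]) : \bar R :=
  let q : R := (2 * k - 1)%N%:R in
  \esum_(nm in [set: nat * nat])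
    (normc (c nm.1) * normc (c nm.2) * q `^ ((nm.1 + nm.2)%N%:R / 2)
     * (1 + minn nm.1 nm.2)%N%:R)%:E.

(* Main.v *)
Require Import Defs.
From HB Require Import structures.
From mathcomp Require Import all_boot all_order all_algebra finmap.
From mathcomp Require Import complex.
From mathcomp Require Import all_classical all_reals all_analysis.
From mathcomp Require summability.
From mathcomp Require Import zify ring lra.
Set Implicit Arguments.
Unset Strict Implicit.
Unset Printing Implicit Defensive.
Import Order.TTheory GRing.Theory Num.Theory.
Import numFieldNormedType.Exports.

(** Join [x] and [z] when [z = a x] for a letter [a].  The free group becomes a
    tree rooted at the identity, of degree [q + 1], in which the distance of [x]
    and [z] is [|z x^-1|] and the level of [x] is [|x|].  A geodesic of length
    [m] from [x] to [z] climbs [i] steps towards the root and then descends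
    [m - i] steps, and about [q ^ (m - i)] points [z] are reached in this way
    from a given [x] ([count_step_le], [count_step_ge]); symmetrically, about
    [q ^ i] points [x] lead to a given [z].

    By duality, both inequalities are about the quadratic form
      [sum_y (sum_(x in F) |f (x y^-1)|) ^ 2]
    for finite sets [F], which should be compared with [A(f) |F|].  Expanding
    the square, its coefficient at [|f_n| |f_m|] is the number of triples
    [(x, x', z)] with [x] and [x'] in [F], at distances [n] and [m] from [z].

    Upper bound.  Fix [n], [m] and the numbers [i], [j] of climbing steps from
    [x] to [z] and from [x'] to [z].  Starting from [x] one finds at most
    [(4/3)^2 q ^ (n - i + j) |F|] triples, and starting from [x'] at most
    [(4/3)^2 q ^ (m - j + i) |F|].  The exponents add up to [n + m], so the
    smaller of the two bounds decays geometrically as they move away from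
    [(n + m) / 2].  For [n <= m] the sum over [j] of the smaller power of [q] is
    thus at most [2 q ^ ((n + m) / 2)], for each of the [n + 1] values of [i]; the
    case [m <= n] is symmetric.  In total there are at most
    [4 (1 + min (n, m)) q ^ ((n + m) / 2) |F|] triples ([triples_upper]).  The
    inequality of Cauchy and Schwarz then bounds [sum_(x in F) (|f| * |g|) (x)]
    by [(4 A(f) |F|)^(1/2) ||g||_2] ([bilinear_upper]), whence the convergence of
    the convolution and both forms of the weak type estimate ([lambda_upper]).

    Lower bound.  Let [F] be a large sphere.  When [n] and [m] have the same
    parity there are exactly [1 + min (n, m)] pairs [(i, j)] with
    [n - 2 i = m - 2 j]; each of them leads back to the sphere, and gives at
    least [(2/3)^2 q ^ ((n + m) / 2) |F|] triples ([triples_lower]).  Pairs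
    [(n, m)] of different parity contribute nothing, but they account for at most
    half of [A(f)]: the kernel [1 + min (n, m)] is positive definite, and remains
    so when it is multiplied by [(-1) ^ (n + m)] ([A_part_even]).  Testing
    [lambda f] on [g = f * chi_F], with [f] truncated, gives
    [||lambda f||^2 >= (2/9) A(f) >= (1/6) A(f)] ([opnorm_lower]). *)

(** * Reduced words *)

Section Words.
Variable k : nat.
Implicit Types (u v w x y z : seq (letter k)) (a b : letter k).

Lemma wmul_cat u v w : wmul (u ++ v) w = wmul u (wmul v w).
Proof. exact: foldr_cat. Qed.

Lemma reduced_cons a b w :
  reduced [:: a, b & w] = (b != linv a) && reduced (b :: w).
Proof. by []. Qed.

Lemma reduced_catr v w : reduced (v ++ w) -> reduced w.
Proof. by elim: v => //= a v IH /path_sorted. Qed.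

Lemma reduced_catl v w : reduced (v ++ w) -> reduced v.
Proof. by rewrite /reduced; case: v => //= a v; rewrite cat_path => /andP[]. Qed.

Lemma reduced_join v a b w : reduced (rcons v a) -> reduced (b :: w) ->
  b != linv a -> reduced (rcons v a ++ b :: w).
Proof.
rewrite /reduced; case: v => [|c v] /= rv rw ba; first by rewrite ba.
by rewrite cat_path rv last_rcons /= ba.
Qed.

Lemma wmul_reduced v w : reduced (v ++ w) -> wmul v w = v ++ w.
Proof.
elim: v => //= a v IH r; rewrite IH; last exact: path_sorted r.
by case: (v ++ w) r => //= b s /andP[/negPf -> _].
Qed.

Lemma winv_cat u v : winv (u ++ v) = winv v ++ winv u.
Proof. by rewrite /winv map_cat rev_cat. Qed.

Lemma size_winv u : size (winv u) = size u.
Proof. by rewrite /winv size_rev size_map. Qed.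

(** In a product of reduced words, the letters that cancel are the last [i]
    letters of the first factor and the first [i] letters of the second. *)
Lemma wmul_drop v x : reduced v -> reduced x -> exists i,
  [/\ (i <= size v)%N, (i <= size x)%N &
      wmul v x = take (size v - i) v ++ drop i x].
Proof.
move=> + rx; elim: v => [_|a v IH rv]; first by exists 0; rewrite drop0.
have rv' : reduced v := path_sorted rv.
have [i [iv ix E]] := IH rv'.
have [lt|ge] := ltnP i (size v).
  exists i; split=> //=; first by rewrite ltnW.
  rewrite E subSn //=; case: v rv {rv' IH iv E} lt => //= b v.
  by rewrite ltnS => /andP[/negPf ba _] lt; rewrite subSn //= ba.
have ei : i = size v by apply/eqP; rewrite eqn_leq iv.
rewrite ei subnn take0 /= in E; rewrite /= E.
case Ex: (drop (size v) x) => [|b s] /=.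
  exists i; rewrite ei subSnn /= take0; split=> //; first by rewrite -ei.
  by rewrite Ex.
case: ifP => _; last first.
  by exists i; rewrite ei subSnn /= take0 Ex; split=> //; rewrite -ei.
have lt : (size v < size x)%N.
  by rewrite ltnNge; apply/negP => /drop_oversize; rewrite Ex.
exists (size v).+1; rewrite subnn /=; split=> //.
by have := drop_nth a lt; rewrite Ex => -[].
Qed.

(** Two words [v ++ z] and [u ++ z] have the quotient [v ++ winv u], provided that
    this word is reduced, that is, that [z] is their longest common suffix. *)
Lemma wmul_common u v z : reduced (u ++ z) -> reduced (v ++ winv u) ->
  wmul (v ++ z) (winv (u ++ z)) = v ++ winv u.
Proof.
move=> ru rv; rewrite wmul_cat winv_cat.
have rw := reduced_winv ru; rewrite winv_cat in rw.
rewrite -(wmul_reduced rw) [wmul z _]wmulA ?(reduced_catr rw) // wmulwV /=.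
exact: wmul_reduced.
Qed.

HB.instance Definition _ := Finite.on (letter k).

(** The reduced words obtained from [w] by adding [j] letters on the left. *)
Fixpoint ext w j : seq (seq (letter k)) :=
  if j is j'.+1 then
    [seq a :: v | v <- ext w j',
                  a <- [seq a <- enum {: letter k} | reduced (a :: v)]]
  else [:: w].

Lemma mem_ext w j y : reduced w ->
  (y \in ext w j) = [&& reduced y, size y == j + size w & drop j y == w].
Proof.
move=> rw; elim: j y => [|j IH] y /=.
  rewrite drop0 inE; apply/eqP/and3P => [->|[_ _ /eqP //]].
  by split.
apply/allpairsPdep/and3P => [[v [a [+ + ->]]]|].
  by rewrite IH mem_filter => /and3P[_ /eqP sv dv] /andP[ra _]; rewrite /= sv.
case: y => [[]|a v [/= ra]]; first by rewrite addSn.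
rewrite addSn eqSS => sv dv; exists v, a; split=> //.
  by rewrite IH sv dv (path_sorted ra : reduced v).
by rewrite mem_filter ra mem_enum.
Qed.

Lemma uniq_ext w j : uniq (ext w j).
Proof.
elim: j => //= j IH; apply: allpairs_uniq_dep => //.
  by move=> v _; rewrite filter_uniq // enum_uniq.
by move=> [v a] [v' a'] _ _ /= [-> ->].
Qed.

Lemma size_reduced_letters b v : reduced (b :: v) ->
  size [seq a <- enum {: letter k} | reduced [:: a, b & v]] = (2 * k - 1)%N.
Proof.
move=> rv; have -> : (2 * k - 1 = #|predC1 (linv b)|)%N.
  by rewrite (cardC1 (linv b)) card_prod card_ord card_bool mulnC subn1.
rewrite cardE enumT /enum_mem; congr size; apply: eq_filter => a.
rewrite reduced_cons rv andbT.
by rewrite !inE -(can_eq (@linvK k) b) linvK eq_sym.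
Qed.

Lemma size_extS w j : reduced w -> (0 < j + size w)%N ->
  size (ext w j.+1) = (size (ext w j) * (2 * k - 1))%N.
Proof.
move=> rw jw; rewrite [ext _ _.+1]/= size_allpairs_dep mulnC -sumn_nseq.
congr sumn; apply: (@eq_from_nth _ 0%N) => [|i]; rewrite size_map ?size_nseq //.
move=> lti; rewrite nth_nseq lti (nth_map [::]) //.
have := mem_nth [::] lti; rewrite mem_ext // => /and3P[].
case: nth => [_ /eqP E|b v rv _ _]; last exact: size_reduced_letters.
by rewrite -E in jw.
Qed.

Lemma size_ext w j : reduced w -> w != [::] ->
  size (ext w j) = ((2 * k - 1) ^ j)%N.
Proof.
move=> rw w0; elim: j => [//|j IH]; rewrite size_extS ?IH ?expnSr //.
by rewrite addn_gt0 orbC lt0n size_eq0 w0.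
Qed.

Lemma size_ext_nil j : size (ext [::] j.+1) = (2 * k * (2 * k - 1) ^ j)%N.
Proof.
elim: j => [|j IH]; last by rewrite size_extS // IH expnSr mulnA.
rewrite /= cats0 size_map (eq_filter (a2 := predT)) ?filter_predT //.
by rewrite -cardT card_prod card_ord card_bool mulnC muln1.
Qed.

(** The constant [4 / 3] comes from [w = [::]], where the first letter is
    unrestricted: [(q + 1) / q <= 4 / 3] for [q >= 3]. *)
Lemma size_ext_le w j : (2 <= k)%N -> reduced w ->
  (3 * size (ext w j) <= 4 * (2 * k - 1) ^ j)%N.
Proof.
move=> hk rw; have [->|w0] := eqVneq w [::]; last first.
  by rewrite size_ext // leq_mul2r orbT.
case: j => [//|j]; rewrite size_ext_nil expnS.
rewrite !mulnA leq_mul2r; apply/orP; right; lia.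
Qed.

End Words.

(** * The tree of the free group *)

Section Tree.
Variable k : nat.
Implicit Types x y z : free_group k.

(** The distance in the tree whose edges join [x] to [a * x] for each letter [a].
    The level of [x] is [fg_length x], its distance to the identity. *)
Definition dist x z : nat := fg_length (z * x^-1)%g.

Lemma distC x z : dist x z = dist z x.
Proof.
rewrite /dist; have -> : (z * x^-1 = (x * z^-1)^-1)%g by rewrite invgM invgK.
exact: size_winv.
Qed.

(** [x] and [z] are at distance [m], and the geodesic from [x] to [z] climbs [i]
    steps towards the root and then descends [m - i] steps: the second condition
    says that the difference of the levels is [m - 2 * i]. *)
Definition step m i x z : bool :=
  (dist x z == m) && (fg_length z + i.*2 == fg_length x + m)%N.

Lemma step_sym m i x z : (i <= m)%N -> step m (m - i) z x = step m i x z.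
Proof.
move=> im; rewrite /step distC; congr (_ && _).
by apply/eqP/eqP; lia.
Qed.

(** [z] descends from the ancestor [drop i x] of [x], where [i] is the number of
    climbing steps. *)
Lemma dist_decomp x z : exists i v,
 [/\ (i <= dist x z)%N, (i <= fg_length x)%N, size v = (dist x z - i)%N &
  word z = v ++ drop i (word x)].
Proof.
have E : (word z = wmul (word (z * x^-1)%g) (word x)).
  by rewrite -[in LHS](mulgVK x z).
have [i [iv ix Ez]] := wmul_drop (valP (z * x^-1)%g) (valP x).
exists i, (take (size (word (z * x^-1)%g) - i) (word (z * x^-1)%g)).
split=> //; last by rewrite E.
by rewrite size_take_min; apply/minn_idPl; rewrite leq_subr.
Qed.

Lemma step_exists m x z : dist x z = m ->
  exists2 i, (i <= m)%N & step m i x z.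
Proof.
move=> <-; have [i [v [im ix sv Ez]]] := dist_decomp x z.
exists i => //; rewrite /step eqxx /= /fg_length Ez size_cat size_drop sv.
rewrite /fg_length in ix; apply/eqP; lia.
Qed.

Lemma step_sum m x z : (dist x z == m = \sum_(i < m.+1) step m i x z :> nat)%N.
Proof.
have [E|ne] := eqVneq (dist x z) m; last first.
  by rewrite big1 // => i _; rewrite /step (negPf ne).
have [i im si] := step_exists E; rewrite (bigD1 (inord i)) //= inordK // si.
rewrite big1 ?addn0 // => j; rewrite -val_eqE /= inordK // => /eqP ji.
case/andP: si => _ /eqP si; apply/eqP; rewrite eqb0; apply/negP => /andP[_ /eqP].
lia.
Qed.

(** The points [z] are among the left extensions of the word [drop i x] by
    [m - i] letters. *)
Lemma count_step_le m i x (Z : seq (free_group k)) : (2 <= k)%N -> uniq Z ->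
  (i <= m)%N -> (3 * \sum_(z <- Z) step m i x z <= 4 * (2 * k - 1) ^ (m - i))%N.
Proof.
move=> hk uZ im; have rx : reduced (drop i (word x)).
  apply: (@reduced_catr _ (take i (word x))).
  by rewrite cat_take_drop; apply: valP.
apply: leq_trans (size_ext_le (m - i) hk rx); rewrite leq_mul2l /=.
rewrite -big_mkcond /= sum1_count -size_filter -(size_map (@word k)).
apply: uniq_leq_size; first by rewrite (map_inj_uniq val_inj) filter_uniq.
move=> w /mapP[z]; rewrite mem_filter => /andP[/andP[/eqP dz /eqP lz] _] ->.
have [i' [v [im' ix sv Ez]]] := dist_decomp x z.
have ei : i' = i.
  move: lz; rewrite /fg_length Ez size_cat size_drop sv dz.
  rewrite /fg_length dz in ix im'; lia.
rewrite mem_ext // (valP z) /= Ez ei size_cat sv ei dz eqxx /=.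
by rewrite drop_size_cat // sv dz ei.
Qed.

(** The left extensions of [drop i x] by [m - i] letters are [q ^ (m - i)] in
    number.  Those which are not at distance [m] from [x] first retrace the last
    climbing step; they are extensions of [drop i.-1 x], hence at most
    [q ^ (m - i).-1] in number, a third of the total or less. *)
Lemma count_step_ge m i x (Z : seq (free_group k)) : (2 <= k)%N ->
  (i <= m)%N -> (i < fg_length x)%N ->
  (forall z, fg_length z + i.*2 = fg_length x + m -> z \in Z)%N ->
  (2 * (2 * k - 1) ^ (m - i) <= 3 * \sum_(z <- Z) step m i x z)%N.
Proof.
move=> hk im ix HZ; set q := (2 * k - 1)%N.
have dropE j : reduced (drop j (word x)).
  apply: (@reduced_catr _ (take j (word x))).
  by rewrite cat_take_drop; apply: valP.
rewrite -big_mkcond /= sum1_count -size_filter -(size_map (@word k)).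
pose good := ext (drop i (word x)) (m - i).
pose bad := if (0 < i)%N && (i < m)%N then ext (drop i.-1 (word x)) (m - i).-1
            else [::].
have sgood : size good = (q ^ (m - i))%N.
  by rewrite size_ext // -size_eq0 size_drop subn_eq0 -ltnNge.
have sbad : (3 * size bad <= q ^ (m - i))%N.
  rewrite /bad; case: ifP => // /andP[i0 lim].
  rewrite size_ext // -?size_eq0 ?size_drop; last first.
    by rewrite subn_eq0 -ltnNge prednK // ltnW.
  rewrite -[in leqRHS](@prednK (m - i)) ?subn_gt0 // expnS leq_mul2r.
  by apply/orP; right; rewrite /q; lia.
pose s := [seq w <- good | w \notin bad].
have ss : (size good <= size s + size bad)%N.
  rewrite -(count_predC (mem bad) good) addnC -size_filter leq_add2l.
  rewrite -size_filter; apply: uniq_leq_size.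
    by rewrite filter_uniq // uniq_ext.
  by move=> w; rewrite mem_filter => /andP[].
apply: (@leq_trans (3 * size s)%N); first by rewrite sgood in ss; lia.
rewrite leq_mul2l /=; apply: uniq_leq_size.
  by rewrite filter_uniq // uniq_ext.
move=> w; rewrite mem_filter mem_ext // => /andP[wbad /and3P[rw sw /eqP dw]].
apply/mapP; exists (FreeGroup rw) => //.
have lw : (size w + i.*2 = fg_length x + m)%N.
  by rewrite (eqP sw) size_drop; rewrite /fg_length in ix *; lia.
rewrite mem_filter HZ // andbT /step lw eqxx andbT /dist /fg_length /=.
pose u := take i (word x); pose v := take (m - i) w.
have Ew : w = v ++ drop i (word x) by rewrite -dw cat_take_drop.
have Ex : word x = u ++ drop i (word x) by rewrite cat_take_drop.
have ru : reduced (u ++ drop i (word x)) by rewrite -Ex; apply: valP.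
rewrite {1}Ew {2}Ex wmul_common //.
  rewrite size_cat size_winv !size_take_min (minn_idPl (ltnW ix)).
  rewrite (eqP sw) (minn_idPl _) ?leq_addr //; apply/eqP; lia.
have rv : reduced v by apply: (@reduced_catl _ _ (drop i (word x))); rewrite -Ew.
have rwu : reduced (winv u) by exact/reduced_winv/(reduced_catl ru).
have sv : size v = (m - i)%N.
  by rewrite size_take_min (eqP sw) (minn_idPl _) // leq_addr.
have su : size u = i by rewrite size_take_min (minn_idPl (ltnW ix)).
case: (lastP v) rv Ew sv => [//|v' a] rv Ew sv.
case: (lastP u) rwu Ex su => [|u' b]; first by rewrite cats0.
move=> rwu Ex su; rewrite size_rcons in sv; rewrite size_rcons in su.
have Eu : winv (rcons u' b) = linv b :: winv u' by rewrite -cats1 winv_cat.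
rewrite Eu in rwu *; apply: reduced_join => //.
(* Equal last letters of [u] and [v] would make [w] an element of [bad]. *)
rewrite (can_eq (@linvK k)); apply: contra wbad => /eqP ba.
have lim : (0 < i)%N && (i < m)%N by lia.
rewrite /bad lim mem_ext // rw -sv /= (eqP sw).
have Ed : drop i.-1 (word x) = a :: drop i (word x).
  by rewrite {1}Ex -su /= cat_rcons drop_size_cat // ba.
rewrite Ed Ew cat_rcons drop_size_cat // eqxx andbT /= size_drop.
by rewrite -sv addSnnS.
Qed.

End Tree.

(** * Counting triples *)

Section Tent.
Variable q : nat.

(** The sum of [q ^ min (e, N - e)] over [0 <= e <= N]. *)
Definition tent N : nat := (\sum_(e < N.+1) q ^ minn e (N - e))%N.

(** The exponents [a + j] form a subinterval of [0, a + b + n]. *)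
Lemma tent_window a b n :
  (\sum_(j < n.+1) q ^ minn (a + j) (b + (n - j)) <= tent (a + b + n))%N.
Proof.
rewrite /tent -(big_mkord predT (fun j => q ^ minn (a + j) (b + (n - j)))%N).
rewrite -(big_mkord predT (fun e => q ^ minn e (a + b + n - e))%N).
rewrite [leqRHS](@big_cat_nat _ _ _ a) /=; [|lia|lia].
rewrite [X in (_ + X)%N](@big_cat_nat _ _ _ (a + n).+1 a) /=; [|lia|lia].
apply: leq_trans (leq_addl _ _); apply: leq_trans (leq_addr _ _).
have -> G : (\sum_(a <= e < (a + n).+1) G e = \sum_(0 <= j < n.+1) G (j + a))%N.
  by rewrite -{1}[a]add0n big_addn -addnS addKn.
rewrite big_nat [leqRHS]big_nat; apply: leq_sum => j /andP[_ jn].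
by apply: eq_leq; congr (_ ^ _)%N; lia.
Qed.

Lemma tentSS N : tent N.+2 = (2 + q * tent N)%N.
Proof.
rewrite /tent big_ord_recr big_ord_recl /= subnn minn0 min0n !expn0.
rewrite addnAC; congr (_ + _)%N; rewrite big_distrr /=; apply: eq_bigr => e _.
by rewrite -expnS; congr (_ ^ _)%N; rewrite /bump; have := ltn_ord e; lia.
Qed.

End Tent.

(** The added [1] makes the induction from [N] to [N.+2] go through. *)
Lemma tent_le (R : realDomainType) (q : nat) (t : R) N :
  (3 <= q)%N -> (0 <= t)%R -> (t ^+ 2 = q%:R)%R ->
  ((tent q N)%:R + 1 <= 2 * t ^+ N)%R.
Proof.
move=> q3 t0 t2; have {}q3 : (3 <= q%:R :> R)%R by rewrite (ler_nat _ 3).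
suff : ((tent q N)%:R + 1 <= 2 * t ^+ N)%R /\
       ((tent q N.+1)%:R + 1 <= 2 * t ^+ N.+1)%R by case.
elim: N => [|N [IH0 IH1]].
  have -> : tent q 0 = 1%N by rewrite /tent big_ord1.
  have -> : tent q 1 = 2%N by rewrite /tent !big_ord_recr big_ord0.
  rewrite expr0 expr1; split; first lra.
  by move: t0 t2 q3; nra.
split=> //; rewrite tentSS natrD natrM exprSr exprSr -mulrA -expr2 t2.
set u := (t ^+ N)%R in IH0 *; set s := ((tent q N)%:R)%R in IH0 *; nra.
Qed.

Section Triples.
Variable k : nat.
Hypothesis hk : (2 <= k)%N.
Let q := (2 * k - 1)%N.
Implicit Types (F Z : seq (free_group k)).

(** The number of triples [(x, x', z)], with [x] and [x'] in [F] and [z] in [Z],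
    such that [z] is at distance [m] from [x] and [n] from [x']. *)
Definition triples m n F Z : nat :=
  (\sum_(z <- Z) (\sum_(x <- F) (dist x z == m)) *
                 (\sum_(x <- F) (dist x z == n)))%N.

(** The number of these triples whose geodesics from [x] and [x'] to [z] climb
    [i] and [j] steps. *)
Definition step_triples m n i j F Z : nat :=
  (\sum_(z <- Z) (\sum_(x <- F) step m i x z) *
                 (\sum_(x <- F) step n j x z))%N.

Lemma triplesE m n F Z :
  triples m n F Z = (\sum_(i < m.+1) \sum_(j < n.+1) step_triples m n i j F Z)%N.
Proof.
rewrite /triples /step_triples; under [RHS]eq_bigr do rewrite exchange_big /=.
rewrite [RHS]exchange_big /=; apply: eq_bigr => z _.
have E l : (\sum_(x <- F) (dist x z == l) =
            \sum_(i < l.+1) \sum_(x <- F) step l i x z)%N.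
  by rewrite exchange_big /=; apply: eq_bigr => x _; rewrite step_sum.
by rewrite 2!E big_distrlr.
Qed.

Lemma step_triplesC m n i j F Z :
  step_triples m n i j F Z = step_triples n m j i F Z.
Proof. by apply: eq_bigr => z _; rewrite mulnC. Qed.

Lemma step_triplesE m n i j F Z : (j <= n)%N -> step_triples m n i j F Z =
  (\sum_(x <- F) \sum_(z <- Z)
     step m i x z * \sum_(x' <- F) step n (n - j) z x')%N.
Proof.
move=> jn; rewrite exchange_big /=; apply: eq_bigr => z _; rewrite big_distrl /=.
apply: eq_bigr => x _; congr (_ * _)%N.
by apply: eq_bigr => x' _; rewrite step_sym.
Qed.

Lemma step_triples_le m n i j F Z :
  uniq F -> uniq Z -> (i <= m)%N -> (j <= n)%N ->
  (9 * step_triples m n i j F Z <= 16 * size F * q ^ (m - i + j))%N.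
Proof.
move=> uF uZ im jn; rewrite step_triplesE // big_distrr /=.
have -> : (16 * size F * q ^ (m - i + j) =
           \sum_(x <- F) 16 * q ^ (m - i + j))%N.
  rewrite big_const_seq count_predT iter_addn_0.
  by rewrite [RHS]mulnC mulnA [(16 * _)%N]mulnC.
apply: leq_sum => x _.
have H1 := count_step_le x hk uZ im.
apply: (@leq_trans (4 * q ^ j * (3 * \sum_(z <- Z) step m i x z))%N); last first.
  by rewrite -/q in H1; rewrite expnD; move: H1; nia.
rewrite mulnA !big_distrr /=; apply: leq_sum => z _.
have H2 := count_step_le z hk uF (leq_subr j n).
rewrite subKn // -/q in H2.
by case: (step m i x z) => /=; rewrite ?muln0 ?mul1n // ?muln1; move: H2; lia.
Qed.

(** The equation between [i] and [j] says that [x] and [x'] are at the same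
    level.  As [m + n < N], the root is not reached. *)
Lemma step_triples_ge m n i j N F Z : (i <= m)%N -> (j <= n)%N ->
  (m + j.*2 = n + i.*2)%N -> (m + n < N)%N ->
  (forall x, (x \in F) = (fg_length x == N)) ->
  (forall x, fg_length x <= N + m -> x \in Z)%N ->
  (4 * size F * q ^ (m - i + j) <= 9 * step_triples m n i j F Z)%N.
Proof.
move=> im jn e mnN HF HZ; rewrite step_triplesE // big_distrr /=.
have -> : (4 * size F * q ^ (m - i + j) =
           \sum_(x <- F) 4 * q ^ (m - i + j))%N.
  rewrite big_const_seq count_predT iter_addn_0.
  by rewrite [RHS]mulnC mulnA [(4 * _)%N]mulnC.
rewrite big_seq [leqRHS]big_seq; apply: leq_sum => x.
rewrite HF => /eqP xN.
have H1 : (2 * q ^ (m - i) <= 3 * \sum_(z <- Z) step m i x z)%N.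
  by apply: count_step_ge => //; [lia|move=> z Ez; apply: HZ; lia].
apply: (@leq_trans (2 * q ^ j * (3 * \sum_(z <- Z) step m i x z))%N).
  by rewrite expnD; move: H1; nia.
rewrite mulnA !big_distrr /=; apply: leq_sum => z _.
case: (boolP (step m i x z)) => [|_]; last by rewrite !muln0.
move=> /andP[_ /eqP lz].
have H2 : (2 * q ^ (n - (n - j)) <= 3 * \sum_(x' <- F) step n (n - j) z x')%N.
  apply: count_step_ge => //; [exact: leq_subr|lia|].
  by move=> x' Ex; rewrite HF; apply/eqP; lia.
by rewrite subKn // in H2; rewrite mul1n; move: H2; lia.
Qed.

Lemma triples_le m n F Z : uniq F -> uniq Z ->
  (9 * triples m n F Z <= 16 * size F * (1 + minn m n) * tent q (m + n))%N.
Proof.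
move=> uF uZ; rewrite triplesE.
(* Counting from [x] gives the first exponent, counting from [x'] the other. *)
have T i j : (i <= m)%N -> (j <= n)%N ->
    (9 * step_triples m n i j F Z <=
     16 * size F * q ^ minn (m - i + j) (i + (n - j)))%N.
  move=> im jn; rewrite /minn; case: ifP => _; first exact: step_triples_le.
  by rewrite step_triplesC addnC; apply: step_triples_le.
have H : (9 * \sum_(i < m.+1) \sum_(j < n.+1) step_triples m n i j F Z <=
    16 * size F * \sum_(i < m.+1) \sum_(j < n.+1)
                    q ^ minn (m - i + j) (i + (n - j)))%N.
  rewrite !big_distrr /=; apply: leq_sum => i _.
  rewrite !big_distrr /=; apply: leq_sum => j _.
  by apply: T; rewrite -ltnS.
apply: leq_trans H _; rewrite -[leqRHS]mulnA leq_mul2l; apply/orP; right.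
have [mn|/ltnW nm] := leqP m n.
  have -> : ((1 + m) * tent q (m + n) = \sum_(i < m.+1) tent q (m + n))%N.
    by rewrite sum_nat_const card_ord add1n.
  apply: leq_sum => i _; apply: leq_trans (tent_window _ _ _ _) _.
  by rewrite subnK // -ltnS.
rewrite exchange_big /=.
have -> : ((1 + n) * tent q (m + n) = \sum_(i < n.+1) tent q (m + n))%N.
  by rewrite sum_nat_const card_ord add1n.
apply: leq_sum => j _; have jn : (j <= n)%N by rewrite -ltnS.
have := tent_window q (n - j) j m; rewrite subnK // [(n + m)%N]addnC.
by apply: leq_trans; apply: leq_sum => i _; rewrite minnC addnC [(j + _)%N]addnC.
Qed.

Lemma triples_ge m n N F Z : odd (m + n) = false -> (m + n < N)%N ->
  (forall x, (x \in F) = (fg_length x == N)) ->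
  (forall x, fg_length x <= N + m -> x \in Z)%N ->
  (4 * size F * (1 + minn m n) * q ^ (m + n)./2 <= 9 * triples m n F Z)%N.
Proof.
move=> ev lN HF HZ; rewrite triplesE.
have T i j : (i <= m)%N -> (j <= n)%N -> (m + j.*2 = n + i.*2)%N ->
    (4 * size F * q ^ (m + n)./2 <= 9 * step_triples m n i j F Z)%N.
  move=> im jn e; have -> : ((m + n)./2 = m - i + j)%N by lia.
  exact: (@step_triples_ge _ _ _ _ N).
rewrite big_distrr /= mulnAC; have [mn|/ltnW nm] := leqP m n.
  have -> : (4 * size F * q ^ (m + n)./2 * (1 + m) =
             \sum_(i < m.+1) 4 * size F * q ^ (m + n)./2)%N.
    by rewrite sum_nat_const card_ord add1n mulnC.
  apply: leq_sum => i _; have im : (i <= m)%N by rewrite -ltnS.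
  (* The unique [j] for which the levels agree. *)
  have jn : (i + (n - m)./2 < n.+1)%N by lia.
  rewrite (bigD1 (Ordinal jn)) //= mulnDr; apply: leq_trans (leq_addr _ _).
  by apply: T => //; lia.
rewrite -big_distrr exchange_big big_distrr /=.
have -> : (4 * size F * q ^ (m + n)./2 * (1 + n) =
             \sum_(i < n.+1) 4 * size F * q ^ (m + n)./2)%N.
  by rewrite sum_nat_const card_ord add1n mulnC.
apply: leq_sum => j _; have jn : (j <= n)%N by rewrite -ltnS.
have im : (j + (m - n)./2 < m.+1)%N by lia.
rewrite (bigD1 (Ordinal im)) //= mulnDr; apply: leq_trans (leq_addr _ _).
by apply: T => //; lia.
Qed.

End Triples.

Section TripleBounds.
Local Open Scope ring_scope.
Variables (R : rcfType) (k : nat).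
Hypothesis hk : (2 <= k)%N.
Let t : R := Num.sqrt (2 * k - 1)%N%:R.

Let t2 : t ^+ 2 = (2 * k - 1)%N%:R.
Proof. by rewrite sqr_sqrtr // ler0n. Qed.

Lemma triples_upper m n (F Z : seq (free_group k)) : uniq F -> uniq Z ->
  (triples m n F Z)%:R <= 4 * t ^+ (m + n) * (1 + minn m n)%N%:R * (size F)%:R.
Proof.
move=> uF uZ; have := triples_le hk m n uF uZ; rewrite -(ler_nat R) !natrM.
have q3 : (3 <= 2 * k - 1)%N by lia.
have := tent_le (m + n) q3 (sqrtr_ge0 _) t2.
have t0 : 0 <= t ^+ (m + n) by rewrite exprn_ge0 // sqrtr_ge0.
set T := t ^+ _ in t0 *; set S := (tent _ _)%:R.
have : 0 <= (size F)%:R * (1 + minn m n)%N%:R :> R by rewrite mulr_ge0.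
set a := (size F)%:R; set b := (1 + _)%N%:R.
move=> ab S1 H.
have : a * b * S <= a * b * (2 * T) by rewrite ler_wpM2l //; lra.
have : 0 <= a * b * T by rewrite mulr_ge0.
lra.
Qed.

Lemma triples_lower m n N (F Z : seq (free_group k)) : odd m = odd n ->
  (m + n < N)%N ->
  (forall x, (x \in F) = (fg_length x == N)) ->
  (forall x, fg_length x <= N + m -> x \in Z)%N ->
  4 / 9 * t ^+ (m + n) * (1 + minn m n)%N%:R * (size F)%:R
    <= (triples m n F Z)%:R.
Proof.
move=> e lN HF HZ.
have ev : odd (m + n) = false by rewrite oddD e addbb.
have := triples_ge hk ev lN HF HZ; rewrite -(ler_nat R) !natrM natrX -t2 -exprM.
rewrite mul2n halfK ev subn0; lra.
Qed.

End TripleBounds.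

Local Open Scope ring_scope.

(** * The quadratic form *)

Lemma sum_cauchy_schwarz (R : realDomainType) (T : Type) (s : seq T)
    (a b : T -> R) :
  (\sum_(i <- s) a i * b i) ^+ 2 <=
  (\sum_(i <- s) a i ^+ 2) * (\sum_(i <- s) b i ^+ 2).
Proof.
have H : 0 <= \sum_(i <- s) \sum_(j <- s) (a i * b j - a j * b i) ^+ 2.
  by apply: sumr_ge0 => i _; apply: sumr_ge0 => j _; apply: sqr_ge0.
have E : \sum_(i <- s) \sum_(j <- s) (a i * b j - a j * b i) ^+ 2 =
  ((\sum_(i <- s) a i ^+ 2) * (\sum_(i <- s) b i ^+ 2) -
   (\sum_(i <- s) a i * b i) ^+ 2) *+ 2.
  rewrite mulrnBl mulr2n {1}big_distrlr /= {1}mulrC big_distrlr /=.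
  rewrite expr2 big_distrlr /= -big_split -sumrMnl -sumrB /=.
  apply: eq_bigr => i _.
  rewrite -big_split -sumrMnl -sumrB /=; apply: eq_bigr => j _; ring.
by rewrite E pmulrn_lge0 // subr_ge0 in H.
Qed.

Section Spheres.
Variable k : nat.

(** The elements of length [N]. *)
Definition sphere N : seq (free_group k) := pmap insub (ext [::] N).

Lemma mem_sphere N x : (x \in sphere N) = (fg_length x == N).
Proof.
rewrite mem_pmap_sub mem_ext // (valP x) addn0 /= /fg_length.
have [<-|//] := eqVneq; exact/eqP/drop_size.
Qed.

Lemma size_sphere N : size (sphere N) = size (ext ([::] : seq (letter k)) N).
Proof.
rewrite size_pmap_sub; apply/eqP; rewrite -all_count; apply/allP => w.
by rewrite mem_ext // => /and3P[].
Qed.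

Lemma size_sphere_gt0 N : (1 <= k)%N -> (0 < size (sphere N))%N.
Proof.
move=> hk; rewrite size_sphere; case: N => [//|N]; rewrite size_ext_nil.
by rewrite muln_gt0 expn_gt0; lia.
Qed.

(** The elements of length at most [N]. *)
Definition wball N : seq (free_group k) :=
  flatten [seq sphere n | n <- iota 0 N.+1].

Lemma mem_wball N x : (x \in wball N) = (fg_length x <= N)%N.
Proof.
apply/flatten_mapP/idP => [[n]|xN]; last first.
  by exists (fg_length x); rewrite ?mem_sphere // mem_iota.
by rewrite mem_iota add0n ltnS => /= nN; rewrite mem_sphere => /eqP ->.
Qed.

End Spheres.

Section Quadratic.
Variables (R : rcfType) (k : nat) (w : nat -> R).
Hypothesis hk : (2 <= k)%N.
Hypothesis w0 : forall n, 0 <= w n.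
Let t : R := Num.sqrt (2 * k - 1)%N%:R.
Implicit Types (F Y : seq (free_group k)) (b : free_group k -> R).

(** The part [n, m < D] of the series [A(f)], for [w n = |f_n|]. *)
Definition A_part D : R :=
  \sum_(n < D) \sum_(m < D) w n * w m * t ^+ (n + m) * (1 + minn n m)%N%:R.

(** The weight [w], cut off at [D]; see [wtruncE]. *)
Definition wtrunc (D l : nat) : R := \sum_(n < D) w n * (l == n :> nat)%:R.

Lemma wtruncE D l : wtrunc D l = if (l < D)%N then w l else 0.
Proof.
rewrite /wtrunc; case: ifPn => [lD|]; last first.
  rewrite -leqNgt => Dl; rewrite big1 // => n _.
  case: eqP => [E|]; rewrite ?mulr0 //.
  by have := ltn_ord n; rewrite -E ltnNge Dl.
rewrite (bigD1 (Ordinal lD)) //= eqxx mulr1 big1 ?addr0 // => n.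
by rewrite -val_eqE eq_sym /= => /negPf ->; rewrite mulr0.
Qed.

Lemma quad_triples D F Y :
  \sum_(y <- Y) (\sum_(x <- F) wtrunc D (dist x y)) ^+ 2 =
  \sum_(n < D) \sum_(m < D) w n * w m * (triples n m F Y)%:R.
Proof.
under [RHS]eq_bigr => n _ do
  under eq_bigr => m _ do rewrite natr_sum big_distrr /=.
under [RHS]eq_bigr => n _ do rewrite exchange_big /=.
rewrite [RHS]exchange_big /=; apply: eq_bigr => y _.
rewrite exchange_big expr2 big_distrlr /=.
apply: eq_bigr => n _; apply: eq_bigr => m _.
by rewrite natrM !natr_sum -!big_distrr /= mulrACA.
Qed.

Lemma quad_upper D F Y : uniq F -> uniq Y ->
  \sum_(y <- Y) (\sum_(x <- F) wtrunc D (dist x y)) ^+ 2 <=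
  4 * A_part D * (size F)%:R.
Proof.
move=> uF uY; rewrite quad_triples -mulrA big_distrl big_distrr /=.
apply: ler_sum => n _; rewrite big_distrl big_distrr /=; apply: ler_sum => m _.
have := triples_upper R hk n m uF uY; rewrite -/t => H.
have ww : 0 <= w n * w m by rewrite mulr_ge0.
apply: le_trans (ler_wpM2l ww H) _.
by rewrite le_eqVlt; apply/orP; left; apply/eqP; ring.
Qed.

(** The dual form of the weak type estimate, for finite sets. *)
Lemma bilinear_upper (A : R) b F Y :
  (forall D, A_part D <= A) -> uniq F -> uniq Y ->
  \sum_(x <- F) \sum_(y <- Y) w (dist x y) * b y <=
  Num.sqrt (4 * A * (size F)%:R) * Num.sqrt (\sum_(y <- Y) b y ^+ 2).
Proof.
move=> HA uF uY.
pose D := (\max_(x <- F) \max_(y <- Y) dist x y).+1.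
have E : \sum_(x <- F) \sum_(y <- Y) w (dist x y) * b y =
    \sum_(y <- Y) (\sum_(x <- F) wtrunc D (dist x y)) * b y.
  rewrite exchange_big /=; apply: eq_big_seq => y yY; rewrite big_distrl /=.
  apply: eq_big_seq => x xF; rewrite wtruncE ltnS.
  have H : (dist x y <= \max_(x <- F) \max_(y <- Y) dist x y)%N.
    apply: leq_trans (leq_bigmax_seq x xF isT).
    exact: (leq_bigmax_seq y yY isT).
  by rewrite H.
rewrite E; apply: le_trans (ler_norm _) _; rewrite -sqrtr_sqr -sqrtrM; last first.
  rewrite !mulr_ge0 //; by apply: le_trans (HA 0%N); rewrite /A_part big_ord0.
apply: ler_wsqrtr; apply: le_trans (sum_cauchy_schwarz _ _ _) _.
apply: ler_wpM2r; first by apply: sumr_ge0 => y _; apply: sqr_ge0.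
apply: le_trans (quad_upper D uF uY) _; rewrite ler_wpM2r // ler_wpM2l //.
Qed.

(** The part of [A_part D] in which [n] and [m] have the same parity. *)
Definition A_even D : R := \sum_(n < D) \sum_(m < D)
  (odd n == odd m)%:R * (w n * w m * t ^+ (n + m) * (1 + minn n m)%N%:R).

Lemma minnE_sum D n m : (n < D)%N -> (m < D)%N ->
  (1 + minn n m)%N%:R = \sum_(l < D) (l <= n)%N%:R * (l <= m)%N%:R :> R.
Proof.
move=> nD mD.
rewrite -(big_mkord predT (fun l => (l <= n)%N%:R * (l <= m)%N%:R)).
have le : (1 + minn n m <= D)%N by lia.
rewrite (@big_cat_nat _ _ _ (1 + minn n m)%N) //= addrC.
rewrite big_nat big1 ?add0r; last first.
  move=> l /andP[] H _; case: leqP; rewrite ?mul0r // => ln.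
  by case: leqP; rewrite ?mulr0 // => lm; lia.
rewrite big_nat (eq_bigr (fun=> 1)) => [|l /andP[_ H]].
  by rewrite -big_nat sumr_const_nat subn0.
have -> : (l <= n)%N by lia.
have -> : (l <= m)%N by lia.
by rewrite mulr1.
Qed.

(** The difference is the quadratic form of the kernel [1 + min (n, m)], which is
    positive definite by [minnE_sum], at the vector [(-1) ^ n w_n t ^ n]. *)
Lemma A_part_even D : A_part D <= 2 * A_even D.
Proof.
rewrite -subr_ge0.
have -> : 2 * A_even D - A_part D =
   \sum_(l < D) (\sum_(n < D) (-1) ^+ n * w n * t ^+ n * (l <= n)%N%:R) ^+ 2.
  under [RHS]eq_bigr do rewrite expr2 big_distrlr /=.
  rewrite [RHS]exchange_big /= big_distrr -sumrB /=; apply: eq_bigr => n _.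
  rewrite [RHS]exchange_big /= big_distrr -sumrB /=; apply: eq_bigr => m _.
  rewrite (minnE_sum (ltn_ord n) (ltn_ord m)) exprD.
  set S := \sum_(l < D) _.
  transitivity (((-1) ^+ n * w n * t ^+ n) * ((-1) ^+ m * w m * t ^+ m) * S).
    rewrite -(signr_odd _ n) -(signr_odd _ m).
    by case: (odd n); case: (odd m) => /=; ring.
  by rewrite big_distrr /=; apply: eq_bigr => l _; ring.
by apply: sumr_ge0 => l _; apply: sqr_ge0.
Qed.

(** The case where [F] is the sphere of radius [N]. *)
Lemma quad_lower D N F Y : (2 * D < N)%N ->
  (forall x, (x \in F) = (fg_length x == N)) ->
  (forall x, fg_length x <= N + D -> x \in Y)%N ->
  2 / 9 * A_part D * (size F)%:R <=
  \sum_(y <- Y) (\sum_(x <- F) wtrunc D (dist x y)) ^+ 2.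
Proof.
move=> DN HF HY; rewrite quad_triples.
apply: (@le_trans _ _ (4 / 9 * A_even D * (size F)%:R)).
  by rewrite ler_wpM2r //; have := A_part_even D; lra.
rewrite -mulrA big_distrl big_distrr /=.
apply: ler_sum => n _; rewrite big_distrl big_distrr /=; apply: ler_sum => m _.
have ww : 0 <= w n * w m by rewrite mulr_ge0.
have [e|_] := eqVneq (odd n) (odd m); last first.
  (* Terms with different parities are dropped. *)
  by rewrite !mul0r mulr0 mulr_ge0.
have := @triples_lower R _ hk n m N F Y e; rewrite -/t => H.
apply: le_trans (ler_wpM2l ww (H _ HF _)); last 2 first.
- by have := ltn_ord n; have := ltn_ord m; lia.
- by move=> x xN; apply: HY; have := ltn_ord n; lia.
rewrite mul1r le_eqVlt; apply/orP; left; apply/eqP; ring.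
Qed.

End Quadratic.

Local Open Scope classical_set_scope.
Local Open Scope ring_scope.
Local Open Scope complex_scope.

(** * Sums over sets and convolutions *)

Section Esum.
Variables (R : realType) (T : choiceType).
Implicit Types a : T -> \bar R.

Lemma sum_le_esum a (F : {fset T}) :
  (\sum_(x <- F) a x <= \esum_(x in [set: T]) a x)%E.
Proof.
apply: esum_ge; exists [set` F]; first by split.
by rewrite fsbig_finite //= set_fsetK.
Qed.

Lemma esum_le a M : (forall F : {fset T}, \sum_(x <- F) a x <= M)%E ->
  (\esum_(x in [set: T]) a x <= M)%E.
Proof.
move=> H; apply: ge_ereal_sup => _ [X [finX _] <-].
by rewrite fsbig_finite.
Qed.

Lemma esum_fset_support a (Y : {fset T}) : (forall x, 0 <= a x)%E ->
  (forall x, x \notin Y -> a x = 0)%E ->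
  \esum_(x in [set: T]) a x = \sum_(x <- Y) a x.
Proof.
move=> a0 aY; rewrite (esumID [set` Y]) // !setTI.
rewrite [X in (_ + X)%E]esum1 ?adde0; last first.
  by move=> x /negP; exact: aY.
by rewrite esum_fset //= fsbig_finite //= set_fsetK.
Qed.

End Esum.

Section Conv.
Variable R : realType.

Lemma le_normc_sum (T : Type) (s : seq T) (h : T -> R[i]) :
  normc (\sum_(i <- s) h i) <= \sum_(i <- s) normc (h i).
Proof.
elim/big_rec2: _ => [|i x y _ H]; first by rewrite normc0.
by apply: le_trans (le_normcD _ _) _; rewrite lerD2l.
Qed.

Lemma normc_ge0 (z : R[i]) : 0 <= normc z.
Proof. by case: z => a b; apply: sqrtr_ge0. Qed.

Lemma norm_normc (z : R[i]) : `|z| = (normc z)%:C.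
Proof. by []. Qed.

Variable G : groupType.
Implicit Types f g : G -> R[i].

(** If the net of partial sums had no limit, its [lim] would be the default point
    [0], so that convergence need not be known here. *)
Lemma normc_conv_le f g x :
  ((normc (Defs.conv f g x))%:E <=
   \esum_(y in [set: G]) (normc (conv_term f g x y))%:E)%E.
Proof.
set S := esum _ _; have S0 : (0 <= S)%E.
  by apply: esum_ge0 => y _; rewrite lee_fin normc_ge0.
case ES: S S0 => [B| |] // S0; last by rewrite leey.
rewrite lee_fin /Defs.conv /summability.sum.
set u := (conv_term f g x : G -> R[i]^o).
have H (J : {fset G}) : normc (summability.partial_sum u J) <= B.
  rewrite -lee_fin -ES /summability.partial_sum.
  rewrite -(big_seq_fsetE _ J predT u) /=.
  apply: le_trans (sum_le_esum _ J); rewrite sumEFin lee_fin.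
  exact: le_normc_sum.
have [cv|/dvgP ->] :=
    pselect (cvg (summability.partial_sum u @ summability.totally)); last first.
  by rewrite normc0 -lee_fin.
set l := lim _; rewrite leNgt; apply/negP => lB.
have d0 : 0 < (normc l - B)%:C :> R[i] by rewrite ltcR subr_gt0.
have FF := @summability.totally_filter G.
have /cvgrPdist_lt/(_ _ d0)/filter_ex[J] := cv.
rewrite -/l norm_normc ltcR ltNge => /negP; apply.
set v := summability.partial_sum u J; have := le_normcD (l - v) v.
rewrite subrK; have := H J; lra.
Qed.

Lemma conv_fset f g (Y : {fset G}) x : (forall y, y \notin Y -> g y = 0) ->
  Defs.conv f g x = \sum_(y <- Y) conv_term f g x y.
Proof.
move=> gY; rewrite /Defs.conv /summability.sum.
set u := (conv_term f g x : G -> R[i]^o).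
have E (J : {fset G}) : (Y `<=` J)%fset ->
    summability.partial_sum u J = \sum_(y <- Y) u y.
  move=> YJ; rewrite /summability.partial_sum -(big_seq_fsetE _ J predT u) /=.
  rewrite [RHS](big_fset_incl _ YJ) // => y _ /gY; rewrite /u /conv_term => ->.
  by rewrite mulr0.
have FF := @summability.totally_filter G.
apply: (@cvg_lim _ (@norm_hausdorff _ R[i]^o)).
apply: cvg_near_cst; exists Y => //= J YJ; exact: E.
Qed.

End Conv.

(** * The series [A(f)] *)

Section ASum.
Variables (R : realType) (k : nat) (c : nat -> R[i]).
Let w n : R := normc (c n).

(** The pairs of numbers less than [D]. *)
Definition square D : {fset nat * nat} :=
  [fset nm in [seq (n, m) | n <- iota 0 D, m <- iota 0 D]]%fset.

Lemma mem_square D nm : (nm \in square D) = (nm.1 < D)%N && (nm.2 < D)%N.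
Proof.
rewrite !inE /=; apply/allpairsP/andP => [[[n m] /= [+ + ->]]|[nD mD]].
  by rewrite !mem_iota !add0n.
by exists nm; rewrite !mem_iota !add0n; case: nm nD mD => n m /= -> ->.
Qed.

(** The terms of [A(f)], with [q ^ ((n + m) / 2)] as a power of [sqrt q]. *)
Definition A_term (nm : nat * nat) : R :=
  w nm.1 * w nm.2 * Num.sqrt (2 * k - 1)%N%:R ^+ (nm.1 + nm.2)
    * (1 + minn nm.1 nm.2)%N%:R.

Lemma A_term_ge0 nm : 0 <= A_term nm.
Proof. by rewrite !mulr_ge0 ?normc_ge0 // exprn_ge0 // sqrtr_ge0. Qed.

Lemma A_sumE : A_sum k c = \esum_(nm in [set: nat * nat]) (A_term nm)%:E.
Proof.
apply: eq_esum => -[n m] _ /=; congr (_ * _ * _)%:E.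
by rewrite mulrC powRrM powR12_sqrt ?ler0n // powR_mulrn // sqrtr_ge0.
Qed.

Lemma A_part_square D : A_part k w D = \sum_(nm <- square D) A_term nm.
Proof.
rewrite (perm_big [seq (n, m) | n <- iota 0 D, m <- iota 0 D]) /=; last first.
  apply: uniq_perm; rewrite ?fset_uniq ?allpairs_uniq ?iota_uniq //.
    by move=> [n m] [n' m'].
  by move=> nm; rewrite !inE.
rewrite big_allpairs_dep /A_part.
rewrite -(big_mkord predT (fun n => \sum_(m < D) A_term (n, nat_of_ord m))).
rewrite /index_iota subn0.
apply: eq_bigr => n _.
by rewrite -(big_mkord predT (fun m => A_term (n, m))) /index_iota subn0.
Qed.

Lemma A_part_le_A_sum D : ((A_part k w D)%:E <= A_sum k c)%E.
Proof.
by rewrite A_part_square A_sumE -sumEFin; apply: sum_le_esum.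
Qed.

Lemma A_sum_le M : (forall D, (A_part k w D)%:E <= M)%E -> (A_sum k c <= M)%E.
Proof.
move=> H; rewrite A_sumE; apply: esum_le => F.
pose D := (\max_(nm <- F) (nm.1 + nm.2)).+1.
pose a nm := (if nm \in square D then (A_term nm)%:E else 0)%E.
apply: le_trans (H D); rewrite A_part_square -sumEFin.
rewrite (eq_big_seq a) => [|nm nF]; last first.
  rewrite /a mem_square; suff -> : (nm.1 < D)%N && (nm.2 < D)%N by [].
  have := leq_bigmax_seq (F := fun nm => nm.1 + nm.2)%N nm nF isT.
  rewrite /D !ltnS => le.
  by rewrite (leq_trans (leq_addr _ _) le) (leq_trans (leq_addl _ _) le).
apply: le_trans (sum_le_esum a F) _; rewrite (esum_fset_support (Y := square D)).
- rewrite le_eqVlt; apply/orP; left.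
  by apply/eqP/eq_big_seq => nm; rewrite /a => ->.
- by move=> nm; rewrite /a; case: ifP; rewrite // lee_fin A_term_ge0.
- by move=> nm /negPf; rewrite /a => ->.
Qed.

End ASum.

(** * The upper bound *)

Section LambdaUpper.
Variables (R : realType) (k : nat) (c : nat -> R[i]).
Hypothesis hk : (2 <= k)%N.
Let w n : R := normc (c n).
Let f : free_group k -> R[i] := radial c.
Implicit Types g : free_group k -> R[i].

Lemma normc_conv_term g x y :
  normc (conv_term f g x y) = w (dist x y) * normc (g y).
Proof. by rewrite /conv_term normcM /f /radial distC. Qed.

(** The square of the norm of [g] in [L^2]. *)
Definition sqnorm g : \bar R :=
  \esum_(x in [set: free_group k]) ((normc (g x)) ^+ 2)%:E.

Lemma lpnorm2 g : lpnorm 2 g = sqrte (sqnorm g).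
Proof.
rewrite /lpnorm -poweR12_sqrt; last first.
  by apply: esum_ge0 => x _; rewrite lee_fin sqr_ge0.
congr (_ `^ _)%E; apply: eq_esum => x _.
by rewrite powR_mulrn ?normc_ge0.
Qed.

Lemma weak_norm2 (h : free_group k -> R[i]) : weak_norm 2 h =
  ereal_sup [set (normc (\sum_(x <- F) h x) / Num.sqrt #|` F|%:R)%:E
            | F in [set F : {fset free_group k} | F != fset0]].
Proof.
rewrite /weak_norm (_ : conj_exp 2 = 2 :> R); last first.
  by rewrite /conj_exp (_ : 2 - 1 = 1) ?divr1 //; ring.
by congr ereal_sup; apply: eq_imagel => F _; rewrite powR12_sqrt.
Qed.

Variables (A : R) (g : free_group k -> R[i]) (G : R).
Hypothesis hA : forall D, A_part k w D <= A.
Hypothesis hG : sqnorm g = G%:E.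

Lemma A_ge0 : 0 <= A.
Proof. by apply: le_trans (hA 0%N); rewrite /A_part big_ord0. Qed.

Let upper_bound (F : {fset free_group k}) : R :=
  Num.sqrt (4 * A) * Num.sqrt G * Num.sqrt #|` F|%:R.

Lemma sum_esum_conv_term (F : {fset free_group k}) :
  (\sum_(x <- F) \esum_(y in [set: free_group k]) (normc (conv_term f g x y))%:E
   <= (upper_bound F)%:E)%E.
Proof.
rewrite -esum_sum; last by move=> y x _ _; rewrite lee_fin normc_ge0.
apply: esum_le => Y.
under eq_bigr do rewrite sumEFin.
rewrite sumEFin lee_fin exchange_big /=.
under eq_bigr do under eq_bigr do rewrite normc_conv_term.
have w0 n : 0 <= w n by exact: normc_ge0.
apply: le_trans (bilinear_upper hk w0 (fun y => normc (g y)) hA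
                  (fset_uniq F) (fset_uniq Y)) _.
rewrite sqrtrM ?mulr_ge0 ?A_ge0 // /upper_bound mulrAC.
rewrite ler_wpM2r ?sqrtr_ge0 // ler_wpM2l ?sqrtr_ge0 // ler_wsqrtr //.
by rewrite -lee_fin -hG -sumEFin; apply: sum_le_esum.
Qed.

(** All three conclusions follow from the bound of [sum_(x in F) |f * g| (x)] by a
    multiple of [|F| ^ (1/2)]: the convergence from singletons [F], the membership
    in weak [L^2] from finite sets [F] on which [|f * g| > s]. *)
Lemma lambda_upper : exists h, [/\ lambda f g = Some h, weakLp 2 h &
  (weak_norm 2 h <= (Num.sqrt (4 * A))%:E * lpnorm 2 g)%E].
Proof.
have H (F : {fset free_group k}) :
    \sum_(x <- F) normc (Defs.conv f g x) <= upper_bound F.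
  rewrite -lee_fin -sumEFin; apply: le_trans (sum_esum_conv_term F).
  by apply: lee_sum => x _; apply: normc_conv_le.
have B0 : 0 <= Num.sqrt (4 * A) * Num.sqrt G by rewrite mulr_ge0 ?sqrtr_ge0.
exists (Defs.conv f g); split.
- rewrite /lambda asboolT // => x; have := sum_esum_conv_term [fset x]%fset.
  by rewrite big_seq_fset1 => /le_lt_trans; apply; apply: ltry.
- rewrite /weakLp /=; apply: (@le_lt_trans _ _
      ((Num.sqrt (4 * A) * Num.sqrt G) ^+ 2)%:E); last exact: ltry.
  apply: ge_ereal_sup => _ [s /= s0 <-].
  set X := [set x | _].
  have HF (F : {fset free_group k}) : [set` F] `<=` X ->
      s ^+ 2 * #|` F|%:R <= (Num.sqrt (4 * A) * Num.sqrt G) ^+ 2.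
    move=> FX; have : s * #|` F|%:R <= upper_bound F.
      apply: le_trans (H F).
      rewrite mulr_natr -iter_addr_0 -count_predT -big_const_seq.
      rewrite big_seq [leRHS]big_seq; apply: ler_sum => x xF.
      by rewrite ltW //; apply: FX.
    rewrite /upper_bound; have := sqr_sqrtr (ler0n R #|` F|).
    have := sqrtr_ge0 (#|` F|%:R : R).
    set r := Num.sqrt _%:R; set B := _ * _ in B0 *.
    rewrite le_eqVlt => /predU1P[<- <- _|r0 <-].
      by rewrite expr0n mulr0 sqr_ge0.
    rewrite expr2 mulrA ler_pM2r // => sr; rewrite -exprMn.
    by rewrite ler_pXn2r // nnegrE ltW // mulr_gt0.
  rewrite (powR_mulrn 2 (ltW s0)) /counting.
  case: asboolP => [fin|/infinite_set_fset inf].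
    by rewrite -EFinM lee_fin; apply: HF; rewrite fset_setK.
  (* An infinite level set would contain finite sets that are too large. *)
  pose M := (Num.sqrt (4 * A) * Num.sqrt G) ^+ 2 / s ^+ 2.
  have [F FX nF] := inf (Num.bound M).
  have := HF F FX; rewrite mulrC -ler_pdivlMr ?exprn_gt0 // -/M leNgt => /negP [].
  apply: lt_le_trans (archi_boundP _) _; last by rewrite ler_nat.
  by rewrite divr_ge0 ?sqr_ge0.
rewrite weak_norm2 lpnorm2 hG /= -EFinM; apply: ge_ereal_sup => _ [F /= F0 <-].
rewrite lee_fin ler_pdivrMr ?sqrtr_gt0 ?ltr0n ?cardfs_gt0 //.
by apply: le_trans (le_normc_sum _ _) _; exact: H.
Qed.

End LambdaUpper.

(** * The lower bound *)

Section LambdaLower.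
Variables (R : realType) (k : nat) (c : nat -> R[i]).
Hypothesis hk : (2 <= k)%N.
Hypothesis c0 : forall n, 0 <= c n.
Let w n : R := normc (c n).
Let f : free_group k -> R[i] := radial c.
Implicit Types (g h : free_group k -> R[i]) (F Y : {fset free_group k}).

Let cE n : c n = (w n)%:C.
Proof. by rewrite -[LHS]ger0_norm. Qed.

Lemma weak_norm2_ge h F : F != fset0 ->
  ((normc (\sum_(x <- F) h x) / Num.sqrt #|` F|%:R)%:E <= weak_norm 2 h)%E.
Proof. by move=> F0; rewrite weak_norm2; apply: ereal_sup_ubound; exists F. Qed.

Lemma lambda_fset g Y : (forall y, y \notin Y -> g y = 0) ->
  lambda f g = Some (Defs.conv f g).
Proof.
move=> gY; rewrite /lambda asboolT // => x.
rewrite (esum_fset_support (Y := Y)); first by rewrite sumEFin ltry.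
- by move=> y; rewrite lee_fin normc_ge0.
- by move=> y /gY; rewrite /conv_term => ->; rewrite mulr0 normc0.
Qed.

Lemma lpnorm2_fset g Y : (forall y, y \notin Y -> g y = 0) ->
  lpnorm 2 g = (Num.sqrt (\sum_(y <- Y) normc (g y) ^+ 2))%:E.
Proof.
move=> gY; rewrite lpnorm2 /sqnorm (esum_fset_support (Y := Y)) ?sumEFin //.
- by move=> y; rewrite lee_fin sqr_ge0.
- by move=> y /gY ->; rewrite normc0 expr0n.
Qed.

(** The norm of [lambda f] tested on a finitely supported [g] and on the indicator
    function of [F]. *)
Lemma opnorm_ge_fset g Y F : (forall y, y \notin Y -> g y = 0) ->
  0 < \sum_(y <- Y) normc (g y) ^+ 2 -> F != fset0 ->
  ((normc (\sum_(x <- F) Defs.conv f g x) / Num.sqrt #|` F|%:R /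
    Num.sqrt (\sum_(y <- Y) normc (g y) ^+ 2))%:E <= weak_opnorm 2 (lambda f))%E.
Proof.
move=> gY; set Q := \sum_(y <- _) _ => Q0 F0.
have sQ : 0 < Num.sqrt Q by rewrite sqrtr_gt0.
apply: (@le_trans _ _ (weak_norm 2 (Defs.conv f g) / lpnorm 2 g)%E).
  rewrite (lpnorm2_fset gY) -/Q inver gt_eqF // EFinM.
  by rewrite lee_wpmul2r ?weak_norm2_ge // lee_fin invr_ge0 ltW.
apply: ereal_sup_ubound; exists g; last by rewrite (lambda_fset gY).
split; first by rewrite /Lp /= (lpnorm2_fset gY) ltry.
move=> g0; move: Q0; rewrite /Q big1 ?ltxx // => y _.
by rewrite g0 normc0 expr0n.
Qed.

Lemma opnorm_ge0 : (0 <= weak_opnorm 2 (lambda f))%E.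
Proof.
pose g (x : free_group k) : R[i] := (x == fg_one k)%:R.
have gY y : y \notin [fset fg_one k]%fset -> g y = 0.
  by rewrite inE /g => /negPf ->.
have Q : 0 < \sum_(y <- [fset fg_one k]%fset) normc (g y) ^+ 2.
  by rewrite big_seq_fset1 /g eqxx normc1 expr1n ltr01.
apply: le_trans (opnorm_ge_fset gY Q (F := [fset fg_one k]%fset) _).
  by rewrite lee_fin !divr_ge0 ?sqrtr_ge0 ?normc_ge0.
by apply/fset0Pn; exists (fg_one k); rewrite inE.
Qed.

Lemma opnorm_lower D :
  ((Num.sqrt (2 / 9 * A_part k w D))%:E <= weak_opnorm 2 (lambda f))%E.
Proof.
have w0 n : 0 <= w n by exact: normc_ge0.
(* [F] is a sphere, and [g] is the convolution of [f], cut off at [D], with the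
   indicator function of [F]. *)
pose N := (2 * D).+1.
pose F : {fset free_group k} := [fset x in sphere k N]%fset.
pose Y : {fset free_group k} := [fset x in wball k (N + D)%N]%fset.
have HF x : (x \in F) = (fg_length x == N) by rewrite !inE mem_sphere.
have HY x : (fg_length x <= N + D)%N -> x \in Y by rewrite in_fset mem_wball.
pose gamma y := \sum_(x <- F) wtrunc w D (dist x y).
pose g y : R[i] := if y \in Y then (gamma y)%:C else 0.
have wt0 l : 0 <= wtrunc w D l by rewrite wtruncE; case: ifP.
have y0 y : 0 <= gamma y by apply: sumr_ge0.
have gY y : y \notin Y -> g y = 0 by rewrite /g => /negPf ->.
have normcr (r : R) : 0 <= r -> normc (r%:C) = r.
  by move=> r0; apply: complexI; rewrite -norm_normc ger0_norm // ler0c.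
have gE : \sum_(y <- Y) normc (g y) ^+ 2 = \sum_(y <- Y) gamma y ^+ 2.
  by apply: eq_big_seq => y yY; rewrite /g yY normcr.
have := quad_lower hk w0 (ltnSn _) HF HY; rewrite -/N.
set Q := \sum_(y <- Y) _ => HQ.
have F0 : F != fset0.
  have := size_sphere_gt0 N (ltnW hk).
  case E : (sphere k N) => [//|x s] _; apply/fset0Pn; exists x.
  by rewrite !inE E inE eqxx.
have cF0 : 0 < #|` F|%:R :> R by rewrite ltr0n cardfs_gt0.
have [Q0|Q0] := leP Q 0.
  have A0 : 2 / 9 * A_part k w D <= 0.
    by rewrite -(pmulr_lle0 _ cF0); apply: le_trans Q0.
  by rewrite ler0_sqrtr //; exact: opnorm_ge0.
apply: le_trans (opnorm_ge_fset gY _ F0); last by rewrite gE.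
rewrite gE -/Q lee_fin.
have convE : \sum_(x <- F) Defs.conv f g x =
    (\sum_(x <- F) \sum_(y <- Y) w (dist x y) * gamma y)%:C.
  rewrite rmorph_sum /=; apply: eq_bigr => x _; rewrite (conv_fset f x gY).
  rewrite rmorph_sum /=; apply: eq_big_seq => y yY.
  by rewrite /conv_term /f /radial cE /g yY rmorphM /= distC.
have QB : Q <= \sum_(x <- F) \sum_(y <- Y) w (dist x y) * gamma y.
  rewrite exchange_big /=; apply: ler_sum => y _; rewrite -big_distrl expr2 /=.
  apply: ler_wpM2r; [exact: y0|apply: ler_sum => x _].
  by rewrite wtruncE; case: ifP.
have B0 := le_trans (ltW Q0) QB.
rewrite convE normcr //.
rewrite ler_pdivlMr ?sqrtr_gt0 // ler_pdivlMr ?sqrtr_gt0 //.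
apply: le_trans QB; rewrite mulrAC -[leRHS](sqr_sqrtr (ltW Q0)) expr2.
apply: ler_wpM2r; first exact: sqrtr_ge0.
by rewrite mulrC -sqrtrM ?ler_wsqrtr // mulrC.
Qed.

End LambdaLower.

Local Open Scope ereal_scope.

Theorem theorem1 (R : realType) (k : nat) (hk : (2 <= k)%N)
    (c : nat -> R[i]) :
  let f : free_group k -> R[i] := radial c in
  (A_sum k c < +oo -> weak_type 2 (lambda f)) /\
  ((forall n : nat, (0 <= c n)%R) ->
     (weak_type 2 (lambda f) -> A_sum k c < +oo) /\
     (6^-1)%:E * A_sum k c <= weak_opnorm 2 (lambda f) ^+ 2 /\
     weak_opnorm 2 (lambda f) ^+ 2 <= 4%:E * A_sum k c).
Proof.
move=> f; pose w n : R := normc (c n).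
have A0 : 0 <= A_sum k c.
  by rewrite A_sumE; apply: esum_ge0 => nm _; rewrite lee_fin A_term_ge0.
have sqnorm_fin (g : free_group k -> R[i]) : 
    Lp 2 g -> exists G : R, sqnorm g = G%:E.
  rewrite /Lp /= lpnorm2.
  have : 0 <= sqnorm g by apply: esum_ge0 => x _; rewrite lee_fin sqr_ge0.
  by case: (sqnorm g) => [G| |] // _ _; exists G.
have upper A g : A_sum k c = A%:E -> Lp 2 g -> exists h,
    [/\ lambda f g = Some h, weakLp 2 h &
     weak_norm 2 h <= (Num.sqrt (4 * A))%:E * lpnorm 2 g].
  move=> EA /sqnorm_fin[G EG]; apply: (lambda_upper hk _ EG) => D.
  by rewrite -lee_fin -EA A_part_le_A_sum.
have opnorm_le C :
    (forall g, Lp 2 g -> exists h, [/\ lambda f g = Some h, weakLp 2 h &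
       weak_norm 2 h <= C%:E * lpnorm 2 g]) ->
    weak_opnorm 2 (lambda f) <= C%:E.
  move=> H; apply: ge_ereal_sup => _ [g [Lg g0] <-].
  have [h [-> _ hC]] := H g Lg; have [G EG] := sqnorm_fin g Lg.
  have G0 : (0 < G)%R.
    have [x gx] : exists x, g x != 0%R.
      apply/not_existsP => gx; apply: g0; apply/funext => x; apply/eqP.
      by have /negP := gx x; rewrite negbK.
    rewrite -lte_fin -EG; apply: lt_le_trans (sum_le_esum _ [fset x]%fset).
    rewrite big_seq_fset1 lte_fin exprn_gt0 // lt_neqAle normc_ge0 andbT eq_sym.
    by apply: contra gx => /eqP/eq0_normc ->.
  move: hC; rewrite lpnorm2 EG /= => hC.
  by rewrite inver gt_eqF ?sqrtr_gt0 // lee_pdivrMr ?sqrtr_gt0.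
split.
  move=> Afin; have EA : A_sum k c = (fine (A_sum k c))%:E.
    by rewrite fineK // ge0_fin_numE.
  by exists (Num.sqrt (4 * fine (A_sum k c))) => g; apply: upper.
move=> c0.
have lower : A_sum k c <= (9 / 2)%:E * weak_opnorm 2 (lambda f) ^+ 2.
  apply: A_sum_le => D; have := opnorm_lower hk c0 D.
  have := opnorm_ge0 k c; rewrite -/f.
  case: (weak_opnorm _ _) => [s| |] //; last first.
    by rewrite expe2 mulyy gt0_muley ?leey // lte_fin divr_gt0.
  rewrite -EFin_expe -EFinM !lee_fin => s0.
  have [a0|a0] := leP 0%R (A_part k w D); last first.
    move=> _; apply: le_trans (ltW a0) _.
    by rewrite mulr_ge0 ?sqr_ge0 // divr_ge0.
  rewrite -ler_sqr ?nnegrE ?sqrtr_ge0 // sqr_sqrtr; last first.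
    by rewrite mulr_ge0 // divr_ge0.
  rewrite -/w; lra.
split; last split.
- move=> [C /opnorm_le H]; apply: le_lt_trans lower _.
  have := opnorm_ge0 k c; rewrite -/f; move: H.
  by case: (weak_opnorm _ _) => [s| |] // _ _; rewrite -EFin_expe -EFinM ltry.
- move: lower; case: (weak_opnorm _ _) => [s| |] //; last 2 first.
  + by rewrite [+oo ^+ 2]expe2 mulyy leey.
  + by rewrite [-oo ^+ 2]expe2 leey.
  rewrite -EFin_expe -EFinM; case: (A_sum k c) A0 => [a| |] // A0.
  rewrite -EFinM !lee_fin; move: A0; rewrite lee_fin; have := sqr_ge0 s; lra.
- case EA: (A_sum k c) A0 => [A| |] // A0; last first.
    by rewrite gt0_muley ?leey // lte_fin.
  have H := opnorm_le _ (fun g => upper A g EA).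
  have H0 := opnorm_ge0 k c; rewrite -/f in H0.
  apply: (@le_trans _ _ ((Num.sqrt (4 * A))%:E ^+ 2)).
    by rewrite lee_sqr // lee_fin sqrtr_ge0.
  by rewrite -EFin_expe sqr_sqrtr ?EFinM // mulr_ge0.
Qed.
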